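(* Let $\zeta\ge 1$, let $\bm{X}_1,\dots,\bm{X}_{\zeta+1}$ and $\bm{Y}_1,\dots,\bm{Y}_\zeta$ be complex $n\times n$ matrices, and decompose each $\bm{X}_p$ as $\bm{X}_p=\bm{X}_{p,P}+\bm{X}_{p,N}$ with $\bm{X}_{p,P}=\sum_{k_p}\sum_{i_p}\lambda_{k_p}\bm{P}_{k_p,i_p}$ and $\bm{X}_{p,N}=\sum_{k_p}\sum_{i_p}\bm{N}_{k_p,i_p}$. Then $$T_{\beta}^{\bm{X}_1,\ldots,\bm{X}_{\zeta+1}}(\bm{Y}_1,\ldots,\bm{Y}_{\zeta})=\sum_{i=1}^{2^{\zeta+1}}T_{\beta}^{[\bm{X}]_{\xi(i)}}(\bm{Y}_1,\ldots,\bm{Y}_{\zeta}),$$ where $[\bm{X}]_{\xi(i)}$ is the array with $\zeta+1$ entries whose $j$-th entry is $\bm{X}_{j,P}$ if $\lfloor (i-1)/2^{j-1}\rfloor\equiv 0 \pmod 2$, and $\bm{X}_{j,N}$ otherwise.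
   Context: Jordan data: every complex $n\times n$ matrix $\bm{X}_p$ is written as $\bm{X}_p=\sum_{k_p=1}^{K_p}\sum_{i_p=1}^{\alpha^{\mathrm G}_{k_p}}\left(\lambda_{k_p}\bm{P}_{k_p,i_p}+\bm{N}_{k_p,i_p}\right)$, where $\lambda_{k_p}$ are the $K_p$ distinct eigenvalues, $\alpha^{\mathrm G}_{k_p}$ is the geometric multiplicity of $\lambda_{k_p}$ (the number of its Jordan blocks), $\bm{P}_{k_p,i_p}$ is the projector onto the invariant subspace of the $i_p$-th Jordan block of $\lambda_{k_p}$ (so $\sum_{k_p,i_p}\bm{P}_{k_p,i_p}=\bm{I}$), and $\bm{N}_{k_p,i_p}$ is the nilpotent part of that block, of order $m_{k_p,i_p}$ (i.e. $\bm{N}_{k_p,i_p}^{\ell}=\bm{0}$ for $\ell\ge m_{k_p,i_p}$). Put $\bm{S}^{(0)}_{k_p,i_p}=\bm{P}_{k_p,i_p}$ and $\bm{S}^{(q)}_{k_p,i_p}=\bm{N}_{k_p,i_p}^{q}$ for $q\ge1$. Generalized multiple operator integral (GMOI): for $\beta$ analytic in a polydisc $|z_l|<R_l$ ($l=1,\dots,\zeta+1$) with all eigenvalues of $\bm{X}_l$ of modulus $<R_l$, $$T_{\beta}^{\bm{X}_1,\ldots,\bm{X}_{\zeta+1}}(\bm{Y}_1,\ldots,\bm{Y}_{\zeta})=\sum_{k_1,\dots,k_{\zeta+1}}\sum_{i_1,\dots,i_{\zeta+1}}\sum_{q_1=0}^{m_{k_1,i_1}-1}\cdots\sum_{q_{\zeta+1}=0}^{m_{k_{\zeta+1},i_{\zeta+1}}-1}\frac{\beta^{(q_1,\dots,q_{\zeta+1})}(\lambda_{k_1},\dots,\lambda_{k_{\zeta+1}})}{q_1!\cdots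 q_{\zeta+1}!}\,\bm{S}^{(q_1)}_{k_1,i_1}\bm{Y}_1\bm{S}^{(q_2)}_{k_2,i_2}\bm{Y}_2\cdots\bm{Y}_\zeta\bm{S}^{(q_{\zeta+1})}_{k_{\zeta+1},i_{\zeta+1}},$$ where $\beta^{(q_1,\dots,q_{\zeta+1})}$ is the partial derivative of order $q_l$ in the $l$-th variable. Partial GMOIs: if in the superscript of $T$ the parameter $\bm{X}_p$ is replaced by $\bm{X}_{p,P}$, the sum over $q_p$ is restricted to $q_p=0$; if it is replaced by $\bm{X}_{p,N}$, the sum over $q_p$ is restricted to $1\le q_p\le m_{k_p,i_p}-1$ (in both cases the eigenvalues, projectors and nilpotents are still those of $\bm{X}_p$). *)

(* Defs.v *)
From HB Require Import structures.
From mathcomp Require Import all_boot all_order all_algebra.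
From mathcomp Require Import all_classical all_reals all_analysis.
From mathcomp Require Import complex.
From mathcomp.analysis.showcase Require summability.

Set Implicit Arguments.
Unset Strict Implicit.
Unset Printing Implicit Defensive.
Import Order.TTheory GRing.Theory Num.Theory numFieldNormedType.Exports.
Local Open Scope classical_set_scope.
Local Open Scope ring_scope.
Local Open Scope complex_scope.

(* A function of m complex variables has type 'rV[R[i]^o]_m -> R[i]^o: the    *)
(* alias R[i]^o of R[i] carries the canonical topology and normed structure.  *)

(* [totally] is the filter of large finite sets of multi-indices, so this is  *)
(* unconditional (equivalently, absolute) convergence of the power series.    *)
Definition analytic_at (R : realType) (m : nat)
    (f : 'rV[R[i]^o]_m -> R[i]^o) (a : 'rV[R[i]^o]_m) : Prop :=
  exists c : {ffun 'I_m -> nat} -> R[i]^o,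
    nbhs a [set w : 'rV[R[i]^o]_m |
      summability.partial_sum
        (fun s : {ffun 'I_m -> nat} =>
           c s * \prod_(l < m) (w 0 l - a 0 l) ^+ s l)
        @ summability.totally --> f w].

Definition polydisc (R : realType) (m : nat) (r : 'I_m -> R) :
    set 'rV[R[i]^o]_m :=
  [set z | forall l : 'I_m, `|z 0 l| < (r l)%:C].

Definition analytic_on (R : realType) (m : nat) (D : set 'rV[R[i]^o]_m)
    (f : 'rV[R[i]^o]_m -> R[i]^o) : Prop :=
  forall a, D a -> analytic_at f a.

(* The order of differentiation is immaterial where f is analytic; the last   *)
(* variable is differentiated first.                                          *)
Definition mixed_partial (R : realType) (m : nat) (q : 'I_m -> nat)
    (f : 'rV[R[i]^o]_m -> R[i]^o) : 'rV[R[i]^o]_m -> R[i]^o :=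
  foldr (fun (l : 'I_m) g => iter (q l) (fun h => 'D_(delta_mx 0 l) h) g)
        f (enum 'I_m).

(* Block i of eigenvalue k: projector jd_P k i and nilpotent part jd_N k i.   *)
(* As jd_P k i has rank jd_m k i, which is also the nilpotency order of       *)
(* jd_N k i, each block is a single Jordan block. [eigenvalue] and            *)
(* [eigenspace] use row vectors, which changes neither the spectrum nor the   *)
(* geometric multiplicities.                                                  *)
Record jordan_data (R : realType) (n : nat) (X : 'M[R[i]]_n) : Type :=
  JordanData {
    jd_K : nat;
    jd_lam : 'I_jd_K -> R[i];
    jd_geo : 'I_jd_K -> nat;
    jd_m : forall k : 'I_jd_K, 'I_(jd_geo k) -> nat;
    jd_P : forall k : 'I_jd_K, 'I_(jd_geo k) -> 'M[R[i]]_n;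
    jd_N : forall k : 'I_jd_K, 'I_(jd_geo k) -> 'M[R[i]]_n;
    jd_lam_inj : injective jd_lam;
    jd_lam_eigenvalue :
      forall a : R[i], eigenvalue X a <-> exists k, jd_lam k = a;
    jd_geoE : forall k, jd_geo k = \rank (eigenspace X (jd_lam k));
    jd_P_idem : forall k (i : 'I_(jd_geo k)), jd_P i * jd_P i = jd_P i;
    jd_P_orth : forall k (i : 'I_(jd_geo k)) k' (i' : 'I_(jd_geo k')),
      Tagged (fun k => 'I_(jd_geo k)) i != Tagged (fun k => 'I_(jd_geo k)) i' ->
      jd_P i * jd_P i' = 0;
    jd_P_sum : \sum_k \sum_(i < jd_geo k) jd_P i = 1;
    jd_P_rank : forall k (i : 'I_(jd_geo k)), \rank (jd_P i) = jd_m i;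
    jd_PN : forall k (i : 'I_(jd_geo k)), jd_P i * jd_N i = jd_N i;
    jd_NP : forall k (i : 'I_(jd_geo k)), jd_N i * jd_P i = jd_N i;
    jd_N_order : forall k (i : 'I_(jd_geo k)) (l : nat),
      jd_N i ^+ l = 0 <-> (jd_m i <= l)%N;
    jd_decomp :
      X = \sum_k \sum_(i < jd_geo k) (jd_lam k *: jd_P i + jd_N i)
  }.

Definition jordan_P (R : realType) (n : nat) (X : 'M[R[i]]_n)
    (J : jordan_data X) : 'M[R[i]]_n :=
  \sum_(k < jd_K J) \sum_(i < jd_geo k) jd_lam k *: jd_P i.

Definition jordan_N (R : realType) (n : nat) (X : 'M[R[i]]_n)
    (J : jordan_data X) : 'M[R[i]]_n :=
  \sum_(k < jd_K J) \sum_(i < jd_geo k) jd_N i.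

Definition jordan_S (R : realType) (n : nat) (X : 'M[R[i]]_n)
    (J : jordan_data X) (k : 'I_(jd_K J)) (i : 'I_(jd_geo k)) (q : nat) :
    'M[R[i]]_n :=
  if q == 0%N then jd_P i else jd_N i ^+ q.

(* A superscript entry of T in position p is X_p, X_{p,P} or X_{p,N}. It is a *)
(* tag rather than a matrix: the eigenvalues, projectors and nilpotents used  *)
(* are those of X_p in all three cases, only the range of q_p changes.        *)
Variant jordan_part : Type := Whole | PPart | NPart.

Definition in_part (t : jordan_part) (q : nat) : bool :=
  match t with
  | Whole => true
  | PPart => q == 0%N
  | NPart => (0 < q)%N
  end.

(* Variables are numbered from 0: position p : 'I_z.+1 is the (p+1)-st        *)
(* parameter, and Y l stands between positions l and l + 1.                   *)
Definition gmoi (R : realType) (n z : nat)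
    (beta : 'rV[R[i]^o]_z.+1 -> R[i]^o)
    (X : 'I_z.+1 -> 'M[R[i]]_n) (J : forall p, jordan_data (X p))
    (t : 'I_z.+1 -> jordan_part) (Y : 'I_z -> 'M[R[i]]_n) : 'M[R[i]]_n :=
  \sum_(k : {dffun forall p : 'I_z.+1, 'I_(jd_K (J p))})
  \sum_(i : {dffun forall p : 'I_z.+1, 'I_(jd_geo (k p))})
  \sum_(q : {dffun forall p : 'I_z.+1, 'I_(jd_m (i p))}
          | [forall p, in_part (t p) (q p)])
    ((mixed_partial (fun p => q p : nat) beta (\row_p jd_lam (k p)) : R[i])
       / (\prod_p (q p)`!)%:R)
    *: (jordan_S (i ord0) (q ord0)
        * \prod_(l < z)
            (Y l * jordan_S (i (lift ord0 l)) (q (lift ord0 l)))).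

(* With j numbered from 0, 2 ^ j is the 2^(j-1) of 1-based numbering.         *)
Definition xi_array (z : nat) (i : nat) (j : 'I_z.+1) : jordan_part :=
  if odd ((i - 1) %/ 2 ^ j) then NPart else PPart.

(* Main.v *)
(** Expanding the partial GMOIs, a multi-index (q_1, ..., q_{z+1}) contributes
    to the i-th term exactly when the p-th binary digit of i - 1 is 1 iff
    q_p > 0. As i - 1 runs over the integers below 2^(z+1), each pattern of
    digits occurs once, so each multi-index is counted once. *)

Require Import Defs.
From HB Require Import structures.
From mathcomp Require Import all_boot all_order all_algebra.
From mathcomp Require Import all_classical all_reals all_analysis.
From mathcomp Require Import complex.
Import Order.TTheory GRing.Theory Num.Theory numFieldNormedType.Exports.
Local Open Scope classical_set_scope.
Local Open Scope ring_scope.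
Local Open Scope complex_scope.

(** Induction on [m]: digit 0 is the remainder mod 2, and digit [p] of [i %/ 2] is digit [p.+1] of
    [i]. *)
Lemma binary_digits_inj (m i j : nat) :
  (i < 2 ^ m)%N -> (j < 2 ^ m)%N ->
  (forall p, (p < m)%N -> odd (i %/ 2 ^ p) = odd (j %/ 2 ^ p)) -> i = j.
Proof.
elim: m i j => [|m IHm] i j; first by rewrite expn0 !ltnS !leqn0 => /eqP-> /eqP->.
move=> lti ltj eq_ij.
have half_lt k : (k < 2 ^ m.+1)%N -> (k %/ 2 < 2 ^ m)%N.
  by rewrite ltn_divLR // -expnSr.
rewrite (divn_eq i 2) (divn_eq j 2) !modn2.
have := eq_ij 0 (ltn0Sn m); rewrite expn0 !divn1 => ->.
congr (_ * 2 + _)%N; apply: IHm; rewrite ?half_lt // => p ltpm.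
by rewrite -!divnMA -!expnS; apply: eq_ij.
Qed.

(** An injection between finite types of the same cardinality [2 ^ m] is bijective, so exactly one
    index has the digits [b]. *)
Lemma sum_binary_digits (V : nmodType) (m : nat) (b : 'I_m -> bool) (c : V) :
  \sum_(i < 2 ^ m | [forall p : 'I_m, odd (i %/ 2 ^ p) == b p]) c = c.
Proof.
pose digits (i : 'I_(2 ^ m)) := [ffun p : 'I_m => odd (i %/ 2 ^ p)].
have digits_inj : injective digits.
  move=> i j /ffunP eq_ij; apply/val_inj.
  apply: (@binary_digits_inj m) => [||p ltpm]; [exact: ltn_ord..|].
  by have := eq_ij (Ordinal ltpm); rewrite !ffunE.
have [|value valueK digitsK] := inj_card_bij digits_inj.
  by rewrite card_ffun card_bool !card_ord.
rewrite (big_pred1 (value (finfun b))) // => i /=.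
rewrite -(inj_eq digits_inj) digitsK.
apply/forallP/eqP => [eq_b|/ffunP eq_b p].
  by apply/ffunP => p; rewrite !ffunE (eqP (eq_b p)).
by have := eq_b p; rewrite !ffunE => ->.
Qed.

Lemma in_part_xi_array (z i : nat) (p : 'I_z.+1) (q : nat) :
  in_part (xi_array i.+1 p) q = (odd (i %/ 2 ^ p) == (0 < q)%N).
Proof. by rewrite /xi_array subn1 /=; case: odd; case: q. Qed.

Theorem proposition1 (R : realType) (n z : nat) (hz : (1 <= z)%N)
    (X : 'I_z.+1 -> 'M[R[i]]_n) (J : forall p, jordan_data (X p))
    (Y : 'I_z -> 'M[R[i]]_n)
    (r : 'I_z.+1 -> R) (beta : 'rV[R[i]^o]_z.+1 -> R[i]^o)
    (hbeta : analytic_on (polydisc r) beta)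
    (hX : forall (p : 'I_z.+1) (a : R[i]),
        eigenvalue (X p) a -> `|a| < (r p)%:C) :
  (forall p, X p = jordan_P (J p) + jordan_N (J p)) /\
  gmoi beta J (fun=> Whole) Y
    = \sum_(1 <= i < (2 ^ z.+1).+1) gmoi beta J (xi_array i) Y.
Proof.
split=> [p|].
  rewrite {1}(jd_decomp (J p)) /jordan_P /jordan_N -big_split /=.
  by apply: eq_bigr => k _; rewrite -big_split.
(* Counting arrays from 0 absorbs the [i - 1] of [xi_array]. The ranges of [k] and [i] are the same
   for all arrays, so the sum over arrays moves inside both. *)
rewrite big_add1 /= big_mkord /gmoi exchange_big /=; apply: eq_bigr => k _.
rewrite exchange_big /=; apply: eq_bigr => i _.
(* The range of [q] does depend on the array: after the exchange [q] is free and the condition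
   restricts the array index instead. *)
rewrite [RHS](exchange_big_dep predT) //=.
rewrite big_mkcond; apply: eq_bigr => q _.
rewrite ifT; last exact/forallP.
(* The summand is constant in the array index, and only the array whose digits mark the positive
   entries of [q] admits [q]. *)
rewrite -[LHS](@sum_binary_digits _ z.+1 (fun p => (0 < q p)%N)).
by apply: eq_bigl => j; apply: eq_forallb => p; rewrite in_part_xi_array.
Qed.
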